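(* Let $d\ge 3$ be an integer. For every $0<p<2$, \[ \min\left\{\frac{\|z\|_p}{\|z\|_2}:\ 0\ne z\in\mathbb C^d,\ \sum_{j=1}^d z_j=0\right\}=\min\left\{\frac{\|x\|_p}{\|x\|_2}:\ 0\ne x\in\mathbb R^d,\ \sum_{j=1}^d x_j=0\right\}, \] and for every $2<q<\infty$, \[ \max\left\{\frac{\|z\|_q}{\|z\|_2}:\ 0\ne z\in\mathbb C^d,\ \sum_{j=1}^d z_j=0\right\}=\max\left\{\frac{\|x\|_q}{\|x\|_2}:\ 0\ne x\in\mathbb R^d,\ \sum_{j=1}^d x_j=0\right\}. \]
   Context: For $z\in\mathbb C^d$ (or $\mathbb R^d$) and $p>0$, $\|z\|_p:=\left(\sum_{j=1}^d|z_j|^p\right)^{1/p}$. *)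

(* Defs.v *)
From mathcomp Require Import all_boot all_order all_algebra.
From mathcomp Require Import all_classical all_reals all_analysis.
From mathcomp Require Export complex.

Set Implicit Arguments.
Unset Strict Implicit.
Unset Printing Implicit Defensive.

Import Order.TTheory GRing.Theory Num.Theory.
Local Open Scope classical_set_scope.
Local Open Scope ring_scope.

(* The modulus on K is passed as an R-valued argument because the norm `|z| of
   R[i] takes its values in R[i] rather than in R. *)
Definition lpnorm (R : realType) (K : Type) (modulus : K -> R) (d : nat)
    (p : R) (z : 'rV[K]_d) : R :=
  (\sum_(j < d) modulus (z ord0 j) `^ p) `^ p^-1.

Definition cmodulus (R : realType) (z : R[i]) : R := ComplexField.Normc.normc z.

Definition rmodulus (R : realType) (x : R) : R := `|x|.

Definition zero_sum_ratios (R : realType) (K : zmodType) (modulus : K -> R)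
    (d : nat) (p : R) : set R :=
  [set lpnorm modulus p z / lpnorm modulus 2 z
    | z in [set z : 'rV[K]_d | z != 0 /\ \sum_(j < d) z ord0 j = 0]].

Definition is_min (R : realType) (A : set R) (m : R) : Prop :=
  A m /\ lbound A m.

Definition is_max (R : realType) (A : set R) (m : R) : Prop :=
  A m /\ ubound A m.

(* Main.v *)
Require Import Defs.
From mathcomp Require Import all_boot all_order all_algebra.
From mathcomp Require Import all_classical all_reals all_analysis.
From mathcomp Require Import ring lra.

Import Order.TTheory GRing.Theory Num.Theory.
Import numFieldNormedType.Exports.
Local Open Scope ring_scope.

(** Real zero-sum vectors are complex zero-sum vectors, so the point is that a
    complex vector [z] does no better than the best real one.  Compare [z] with
    the real vectors [Re (u z)] and [Im (u z)], where [u] runs over the unit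
    circle; they again have sum zero.

    Let [p < 2], let [kappa] be the minimum of [sum |x_j|^p] over the real
    zero-sum vectors of Euclidean norm 1, put [N = sum |z_j|^2],
    [psi t = t^(p/2)], and let [A], [B] be the squared Euclidean norms of
    [Re (u z)] and [Im (u z)].  Then [A + B = N], and [A - B] is the real part
    of [u^2 s] with [s = sum z_j^2].  Write [s = |s| b^2] with [|b| = 1].  As
    [|s| <= N], the pair [(A, B)] is less spread out than the pair
    [(N (Re ub)^2, N (Im ub)^2)], which has the same sum, so concavity of [psi]
    ([signed_concave_majorization]) gives
    [psi A + psi B >= psi N * G (u b)] with [G v = |Re v|^p + |Im v|^p].
    Writing [z_j = |z_j| a_j] with [|a_j| = 1], the real inequality for
    [Re (u z)] and [Im (u z)] becomes, for every unit [u],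
    [sum |z_j|^p G (u a_j) >= kappa psi N G (u b)]
    ([complexify_pointwise]).

    Averaging over the circle would replace all the values of [G] by one
    positive number and leave [sum |z_j|^p >= kappa psi N], which is the claim
    for [z].  As only finitely many rotations occur, it is enough to average
    over long finite orbits of these commuting rotations
    ([bounded_coboundary_sum_lt], [sum_ge0_of_shifts]).

    For exponents [q > 2] the function [psi] is convex and all inequalities are
    reversed.  Both cases are treated at once by a sign [e], equal to [1] for
    minima and to [-1] for maxima: an inequality [P >= Q] that has to be
    reversed in the second case is written [0 <= e * (P - Q)].  The real
    extremum exists by compactness ([signed_real_extremum]). *)

(** * Averaging over finitely many shifts *)

(** A finite sum of coboundaries of bounded functions has mean zero, so it
    cannot stay above a positive constant.  Induction on the number of shifts:
    summing along an orbit of length [n] of the last shift makes the last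
    coboundary telescope, so that it contributes at most [2 B], which is
    negligible against [n * eps]; the other terms remain coboundaries because
    the shifts commute. *)
Lemma bounded_coboundary_sum_lt (R : realType) (K : comPzRingType)
    (D : K -> Prop) (m : nat) (f : 'I_m -> K -> R) (a : 'I_m -> K) (B eps : R) :
  D 1 -> (forall x y, D x -> D y -> D (x * y)) ->
  (forall i, D (a i)) -> (forall i x, D x -> `|f i x| <= B) -> 0 < eps ->
  exists2 x, D x & \sum_(i < m) (f i (x * a i) - f i x) < eps.
Proof.
move=> D1 DM; elim: m f a B eps => [|m IH] f a B eps Da fB e0.
  by exists 1 => //; rewrite big_ord0.
have B0 : 0 <= B by apply: le_trans (fB ord0 1 D1).
(* An orbit so long that the telescoping term, at most 2 B, costs less than
   half of n * eps; the other half is left to the induction hypothesis. *)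
pose n := (Num.bound (4 * B / eps)).+1.
have n0 : 0 < n%:R :> R by rewrite ltr0n.
have nB : 2 * B < n%:R * (eps / 2).
  have : 4 * B / eps < n%:R.
    apply: lt_le_trans (archi_boundP _) _; last by rewrite ler_nat.
    by rewrite divr_ge0 ?mulr_ge0// ltW.
  by rewrite ltr_pdivrMr//; lra.
have DX k : D (a ord_max ^+ k) by elim: k => [|k ih]; rewrite ?expr0 ?exprS//; apply: DM.
pose emb := widen_ord (leqnSn m).
pose g i x := \sum_(k < n) f (emb i) (x * a ord_max ^+ k).
have gB i x : D x -> `|g i x| <= n%:R * B.
  move=> Dx; apply: le_trans (ler_norm_sum _ _ _) _.
  rewrite mulr_natl -[in leRHS](card_ord n) -sumr_const.
  by apply: ler_sum => k _; apply/fB/DM.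
have [|x Dx xP] := IH g (a \o emb) (n%:R * B) (n%:R * (eps / 2)) (fun i => Da _) gB.
  by rewrite mulr_gt0// divr_gt0.
pose F k := \sum_(i < m.+1) (f i (x * a ord_max ^+ k * a i) - f i (x * a ord_max ^+ k)).
have : \sum_(k < n) F k < n%:R * eps.
  under eq_bigr do rewrite /F big_ord_recr/=.
  rewrite big_split/= exchange_big/=.
  have -> : n%:R * eps = n%:R * (eps / 2) + n%:R * (eps / 2) by field.
  apply: ltrD.
    congr (_ < _): xP; apply: eq_bigr => i _.
    rewrite /g -sumrB; apply: eq_bigr => k _.
    by rewrite mulrAC.
  apply: le_lt_trans nB.
  have -> : \sum_(k < n) (f ord_max (x * a ord_max ^+ k * a ord_max)
                          - f ord_max (x * a ord_max ^+ k)) =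
      f ord_max (x * a ord_max ^+ n) - f ord_max (x * a ord_max ^+ 0).
    rewrite -(telescope_sumr (fun k => f ord_max (x * a ord_max ^+ k))
             (leq0n n)) big_mkord.
    by apply: eq_bigr => k _; rewrite exprSr mulrA.
  have := fB ord_max _ (DM _ _ Dx (DX n)); have := fB ord_max _ (DM _ _ Dx (DX 0%N)).
  by rewrite !ler_norml => /andP[? ?] /andP[? ?]; lra.
move=> Flt.
(* The orbit sum of the coboundaries is below n * eps, so one term is below
   eps. *)
have [k Fk] : exists k : 'I_n, F k < eps.
  apply/not_existsP => H; move: Flt; apply/negP; rewrite -leNgt.
  rewrite mulr_natl -[in leLHS](card_ord n) -sumr_const.
  by apply: ler_sum => k _; rewrite leNgt; apply/negP/H.
by exists (x * a ord_max ^+ k) => //; apply: DM.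
Qed.

(** If [G] had an invariant mean, averaging the hypothesis would give
    [(sum c_i) * mean G >= 0] with [mean G >= delta > 0].  Were [sum c_i]
    negative, the coboundaries of the functions [c_i G] would sum to at least
    [- (sum c_i) * delta] everywhere. *)
Lemma sum_ge0_of_shifts (R : realType) (K : comPzRingType)
    (D : K -> Prop) (m : nat) (c : 'I_m -> R) (a : 'I_m -> K) (G : K -> R)
    (B delta : R) :
  D 1 -> (forall x y, D x -> D y -> D (x * y)) -> (forall i, D (a i)) ->
  (forall x, D x -> delta <= G x <= B) -> 0 < delta ->
  (forall x, D x -> 0 <= \sum_(i < m) c i * G (x * a i)) ->
  0 <= \sum_(i < m) c i.
Proof.
move=> D1 DM Da GB d0 H; rewrite leNgt; apply/negP => C0.
pose C := \sum_(i < m) `|c i|.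
have B0 : 0 <= B.
  by have /andP[h1 h2] := GB 1 D1; rewrite (le_trans _ h2)// (le_trans _ h1)// ltW.
have GB' x : D x -> `|G x| <= B.
  by move=> /GB/andP[h1 h2]; rewrite ger0_norm// (le_trans _ h1)// ltW.
pose f i x := c i * G x.
have fB i x : D x -> `|f i x| <= C * B.
  move=> /GB' GBx; rewrite /f normrM ler_pM//.
  by rewrite /C (bigD1 i)//= lerDl sumr_ge0.
have e0 : 0 < - (\sum_(i < m) c i) * delta by rewrite mulr_gt0 ?oppr_gt0.
have [x Dx] := bounded_coboundary_sum_lt _ _ _ _ _ _ _ _ D1 DM Da fB e0.
apply/negP; rewrite -leNgt.
have -> : \sum_(i < m) (f i (x * a i) - f i x) =
    \sum_(i < m) c i * G (x * a i) - (\sum_(i < m) c i) * G x.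
  by rewrite mulr_suml -sumrB; apply: eq_bigr => i _.
have /andP[h1 h2] := GB x Dx.
by have := H x Dx; nra.
Qed.

(** * Concavity and convexity of powers *)

(** Concavity on the nonnegative half-line for [e = 1], convexity for
    [e = -1]. *)
Definition signed_concave (R : realType) (e : R) (psi : R -> R) : Prop :=
  forall t x y, 0 <= t <= 1 -> 0 <= x -> 0 <= y ->
    0 <= e * (psi (t * x + (1 - t) * y) - (t * psi x + (1 - t) * psi y)).

Lemma signed_concave_convex_powR (R : realType) (s : R) : 1 <= s ->
  signed_concave R (- 1) (fun x => x `^ s).
Proof.
move=> s1 t x y /andP[t0 t1] x0 y0.
have := @convex_powR R s s1 (Itv01 t0 t1) x y.
rewrite !inE/= !in_itv/= !andbT => /(_ x0 y0).
by rewrite !convRE/= /unstable.onem => h; rewrite mulN1r oppr_ge0 subr_le0.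
Qed.

(** The map [x |-> x^s] is the inverse of the increasing convex map
    [x |-> x^(1/s)]. *)
Lemma signed_concave_powR (R : realType) (s : R) : 0 < s -> s <= 1 ->
  signed_concave R 1 (fun x => x `^ s).
Proof.
move=> s0 s1 t x y /[dup] t01 /andP[t0 t1] x0 y0.
have r1 : 1 <= s^-1 by rewrite invf_ge1.
have := signed_concave_convex_powR R s^-1 r1 t (x `^ s) (y `^ s) t01
  (powR_ge0 _ _) (powR_ge0 _ _).
have sK w : 0 <= w -> (w `^ s) `^ s^-1 = w.
  by move=> w0; rewrite -powRrM mulfV ?gt_eqF// powRr1.
have u0 : 0 <= 1 - t by rewrite subr_ge0.
rewrite !sK// mulN1r oppr_ge0 subr_le0 mul1r subr_ge0 => h.
have := ge0_ler_powR (ltW s0) _ _ h.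
rewrite !nnegrE powR_ge0 => /(_ isT).
rewrite -powRrM mulVf ?gt_eqF// powRr1; first by apply; rewrite addr_ge0 ?mulr_ge0.
by rewrite addr_ge0 ?mulr_ge0 ?powR_ge0.
Qed.

(** Two-point Karamata inequality: as [(a, b)] has the same sum as [(c, d)] and
    is less spread out, [a] and [b] are the convex combinations of [c] and [d]
    with weights [t, 1 - t] and [1 - t, t]. *)
Lemma signed_concave_majorization (R : realType) (e : R) (psi : R -> R)
    (a b c d : R) :
  signed_concave R e psi -> 0 <= c -> 0 <= d -> a + b = c + d ->
  `|a - b| <= `|c - d| -> 0 <= e * (psi a + psi b - (psi c + psi d)).
Proof.
move=> He c0 d0 abcd; have [cd|cd] := eqVneq c d.
  rewrite cd in abcd *.
  rewrite subrr normr0 normr_le0 subr_eq0 => /eqP ab.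
  have -> : b = d by move: abcd; rewrite ab; lra.
  have -> : a = d by move: abcd; rewrite ab; lra.
  by rewrite subrr mulr0.
move=> H.
have cd0 : c - d != 0 by rewrite subr_eq0.
pose t := (a - d) / (c - d).
have t01 : 0 <= t <= 1.
  (* 2 t - 1 is the ratio of the two differences. *)
  have : `|2 * t - 1| <= 1.
    have -> : 2 * t - 1 = (a - b) / (c - d).
      have -> : b = c + d - a by rewrite -abcd; ring.
      by rewrite /t; field.
    by rewrite normf_div ler_pdivrMr ?normr_gt0// mul1r.
  by rewrite ler_norml => /andP[h1 h2]; apply/andP; split; lra.
have ea : a = t * c + (1 - t) * d by rewrite /t; field.
have eb : b = t * d + (1 - t) * c.
  have -> : b = c + d - a by rewrite -abcd; ring.
  by rewrite /t; field.
have := addr_ge0 (He t c d t01 c0 d0) (He t d c t01 d0 c0).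
by rewrite -ea -eb -mulrDr; congr (0 <= _ * _); ring.
Qed.

(** * Complex numbers in coordinates *)

Local Notation Re := complex.Re.
Local Notation Im := complex.Im.

Lemma normc_sqr (R : realType) (z : R[i]) :
  cmodulus z ^+ 2 = Re z ^+ 2 + Im z ^+ 2.
Proof. by case: z => a b; rewrite /cmodulus/= sqr_sqrtr// addr_ge0 ?sqr_ge0. Qed.

Lemma cmodulus_ge0 (R : realType) (z : R[i]) : 0 <= cmodulus z.
Proof. by case: z => a b; rewrite /cmodulus/= sqrtr_ge0. Qed.

Lemma polar (R : realType) (z : R[i]) :
  exists2 a : R[i], cmodulus a = 1 & z = (cmodulus z)%:C%C * a.
Proof.
have [->|z0] := eqVneq z 0.
  exists 1; rewrite /cmodulus ?ComplexField.Normc.normc1//.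
  by rewrite ComplexField.Normc.normc0 mul0r.
have r0 : cmodulus z != 0.
  by apply: contra_neq z0; exact: ComplexField.Normc.eq0_normc.
have rC : ((cmodulus z)%:C)%C != 0 :> R[i].
  by apply: contra_neq r0 => -[].
exists (z / ((cmodulus z)%:C)%C); last by rewrite mulrC divfK.
rewrite {1}/cmodulus ComplexField.Normc.normcM ComplexField.Normc.normcV.
have -> : ComplexField.Normc.normc ((cmodulus z)%:C)%C = cmodulus z :> R.
  by rewrite /= expr0n addr0 sqrtr_sqr ger0_norm// cmodulus_ge0.
by rewrite mulfV.
Qed.

Lemma unit_sqrt (R : realType) (a : R[i]) : cmodulus a = 1 ->
  exists2 b : R[i], cmodulus b = 1 & a = b ^+ 2.
Proof.
move=> a1; exists (sqrtc a); last by rewrite sqr_sqrtc.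
apply/eqP; rewrite -(@eqrXn2 _ 2) ?cmodulus_ge0// expr1n expr2.
by rewrite /cmodulus -ComplexField.Normc.normcM -expr2 sqr_sqrtc -/(cmodulus a) a1.
Qed.

Lemma Re_sum (R : realType) (d : nat) (z : 'I_d -> R[i]) :
  Re (\sum_(j < d) z j) = \sum_(j < d) Re (z j).
Proof. by apply: (big_morph (@complex.Re R)) => // -[a b] [c e]. Qed.

Lemma Im_sum (R : realType) (d : nat) (z : 'I_d -> R[i]) :
  Im (\sum_(j < d) z j) = \sum_(j < d) Im (z j).
Proof. by apply: (big_morph (@complex.Im R)) => // -[a b] [c e]. Qed.

Lemma Re_realM (R : realType) (r : R) (z : R[i]) : Re (r%:C%C * z) = r * Re z.
Proof. by case: z => a b /=; rewrite mul0r subr0. Qed.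

Lemma Im_realM (R : realType) (r : R) (z : R[i]) : Im (r%:C%C * z) = r * Im z.
Proof. by case: z => a b /=; rewrite mul0r addr0. Qed.

Lemma Re_sqr (R : realType) (z : R[i]) : Re (z ^+ 2) = Re z ^+ 2 - Im z ^+ 2.
Proof. by case: z => a b; rewrite !expr2. Qed.

(** * Transfer of the real inequality to complex vectors *)

Lemma normr_powR_half (R : realType) (p x : R) : `|x| `^ p = (x ^+ 2) `^ (p / 2).
Proof.
rewrite -real_normK ?num_real// -powR_mulrn ?normr_ge0// -powRrM.
by rewrite mulrC divfK// pnatr_eq0.
Qed.

(** The function on the unit circle whose rotates are averaged.  Adding the
    imaginary part makes it bounded away from zero there. *)
Definition split_norm (R : realType) (p : R) (v : R[i]) : R :=
  `|Re v| `^ p + `|Im v| `^ p.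

Lemma split_norm_bounds (R : realType) (p : R) (v : R[i]) : 0 < p ->
  cmodulus v = 1 -> 2^-1 `^ (p / 2) <= split_norm R p v <= 2.
Proof.
move=> p0 v1; have := normc_sqr R v; rewrite v1 expr1n => E.
have p2 : 0 <= p / 2 by rewrite divr_ge0// ltW.
have hr := sqr_ge0 (Re v); have hi := sqr_ge0 (Im v).
rewrite /split_norm !normr_powR_half.
have mono x y : 0 <= x -> x <= y -> x `^ (p / 2) <= y `^ (p / 2).
  by move=> x0 xy; apply: ge0_ler_powR; rewrite // nnegrE// (le_trans x0).
have one : 1 `^ (p / 2) = 1 :> R by rewrite powR1.
apply/andP; split; last first.
  have h1 : (Re v ^+ 2) `^ (p / 2) <= 1 by rewrite -[leRHS]one; apply: mono => //; lra.
  have h2 : (Im v ^+ 2) `^ (p / 2) <= 1 by rewrite -[leRHS]one; apply: mono => //; lra.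
  by lra.
(* One of the two squares is at least 1/2, as they add up to 1. *)
have [h|h] := leP (2^-1) (Re v ^+ 2).
  by rewrite (le_trans (mono _ _ _ h))// ?lerDl ?powR_ge0// invr_ge0.
by rewrite (le_trans (mono _ (Im v ^+ 2) _ _))// ?lerDr ?powR_ge0// ?invr_ge0//; lra.
Qed.

(** Sum of the real inequalities for [Re z] and [Im z], whose squared norms
    have sum [N] and difference [r * Re (b ^ 2)], combined with the majorization
    of these norms by [N (Re b)^2] and [N (Im b)^2]. *)
Lemma complexify_pointwise (R : realType) (d : nat) (p e kappa : R)
    (z : 'rV[R[i]]_d) (b : R[i]) (r : R) :
  0 < p -> 0 <= kappa -> signed_concave R e (fun x => x `^ (p / 2)) ->
  (forall x : 'rV[R]_d, \sum_(j < d) x ord0 j = 0 ->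
    0 <= e * (\sum_(j < d) `|x ord0 j| `^ p
              - kappa * (\sum_(j < d) x ord0 j ^+ 2) `^ (p / 2))) ->
  \sum_(j < d) z ord0 j = 0 ->
  cmodulus b = 1 -> `|r| <= \sum_(j < d) cmodulus (z ord0 j) ^+ 2 ->
  \sum_(j < d) z ord0 j ^+ 2 = r%:C%C * b ^+ 2 ->
  0 <= e * (\sum_(j < d) split_norm R p (z ord0 j)
    - kappa * (\sum_(j < d) cmodulus (z ord0 j) ^+ 2) `^ (p / 2)
      * split_norm R p b).
Proof.
move=> p0 k0 conc real z0 b1 rN zb.
set N := \sum_(j < d) _ in rN *.
have N0 : 0 <= N by apply: sumr_ge0 => j _; exact: sqr_ge0.
pose x := \row_j Re (z ord0 j); pose y := \row_j Im (z ord0 j).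
have x0 : \sum_(j < d) x ord0 j = 0.
  by under eq_bigr do rewrite mxE; rewrite -Re_sum z0.
have y0 : \sum_(j < d) y ord0 j = 0.
  by under eq_bigr do rewrite mxE; rewrite -Im_sum z0.
pose A := \sum_(j < d) x ord0 j ^+ 2; pose B := \sum_(j < d) y ord0 j ^+ 2.
have AB : A + B = N.
  by rewrite /A /B /N -big_split; apply: eq_bigr => j _; rewrite !mxE normc_sqr.
have ABd : A - B = r * Re (b ^+ 2).
  rewrite -Re_realM -zb Re_sum /A /B -sumrB.
  by apply: eq_bigr => j _; rewrite !mxE Re_sqr.
have bb : Re b ^+ 2 + Im b ^+ 2 = 1 by rewrite -normc_sqr b1 expr1n.
have maj : 0 <= e * (A `^ (p / 2) + B `^ (p / 2) -
    ((N * Re b ^+ 2) `^ (p / 2) + (N * Im b ^+ 2) `^ (p / 2))).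
  apply: (signed_concave_majorization _ _ _ _ _ _ _ conc).
  - by rewrite mulr_ge0// sqr_ge0.
  - by rewrite mulr_ge0// sqr_ge0.
  - by rewrite -mulrDr bb mulr1.
  - by rewrite ABd -mulrBr -Re_sqr !normrM ler_wpM2r// (ger0_norm N0).
have hx := real x x0; have hy := real y y0.
have -> : \sum_(j < d) split_norm R p (z ord0 j) =
    \sum_(j < d) `|x ord0 j| `^ p + \sum_(j < d) `|y ord0 j| `^ p.
  by rewrite -big_split; apply: eq_bigr => j _; rewrite !mxE.
have := addr_ge0 (addr_ge0 hx hy) (mulr_ge0 k0 maj).
rewrite (powRM _ N0 (sqr_ge0 (Re b))) (powRM _ N0 (sqr_ge0 (Im b))) -/A -/B.
rewrite /split_norm.
rewrite (normr_powR_half _ _ (Re b)) (normr_powR_half _ _ (Im b)).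
by congr (0 <= _); ring.
Qed.

(** Apply the pointwise inequality to all rotations [u z] and average over
    [u]. *)
Lemma complexify (R : realType) (d : nat) (p e kappa : R) (z : 'rV[R[i]]_d) :
  0 < p -> 0 <= kappa -> signed_concave R e (fun x => x `^ (p / 2)) ->
  (forall x : 'rV[R]_d, \sum_(j < d) x ord0 j = 0 ->
    0 <= e * (\sum_(j < d) `|x ord0 j| `^ p
              - kappa * (\sum_(j < d) x ord0 j ^+ 2) `^ (p / 2))) ->
  \sum_(j < d) z ord0 j = 0 ->
  0 <= e * (\sum_(j < d) cmodulus (z ord0 j) `^ p
    - kappa * (\sum_(j < d) cmodulus (z ord0 j) ^+ 2) `^ (p / 2)).
Proof.
move=> p0 k0 conc real z0.
set N := \sum_(j < d) _ ^+ 2.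
have [a a1 za] : exists2 a : 'I_d -> R[i], (forall j, cmodulus (a j) = 1) &
    forall j, z ord0 j = (cmodulus (z ord0 j))%:C%C * a j.
  have /choice[a Ha] : forall j, exists a, cmodulus a = 1 /\
      z ord0 j = (cmodulus (z ord0 j))%:C%C * a.
    by move=> j; have [a ? ?] := polar R (z ord0 j); exists a.
  by exists a => j; case: (Ha j).
pose s := \sum_(j < d) z ord0 j ^+ 2.
have [_ /unit_sqrt[b b1 ->] sb] := polar R s.
have normM u v : cmodulus (u * v) = cmodulus u * cmodulus v :> R.
  exact: ComplexField.Normc.normcM.
have sN : `|cmodulus s| <= N.
  rewrite ger0_norm ?cmodulus_ge0//.
  have -> : N = \sum_(j < d) cmodulus (z ord0 j ^+ 2).
    by apply: eq_bigr => j _; rewrite !expr2 normM.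
  rewrite /s; elim/big_ind2: _ => //.
  - by rewrite /cmodulus ComplexField.Normc.normc0.
  - by move=> u1 u2 v1 v2 h1 h2; apply: le_trans (le_normcD _ _) (lerD h1 h2).
(* Index 0 carries the rotation by b, index j + 1 the rotation by the phase
   of z_j. *)
pose c (i : 'I_d.+1) :=
  if unlift ord0 i is Some j then e * cmodulus (z ord0 j) `^ p
  else - (e * (kappa * N `^ (p / 2))).
pose sh (i : 'I_d.+1) := if unlift ord0 i is Some j then a j else b.
have -> : e * (\sum_(j < d) cmodulus (z ord0 j) `^ p - kappa * N `^ (p / 2)) =
    \sum_i c i.
  rewrite big_ord_recl {1}/c unlift_none mulrBr addrC mulr_sumr.
  by congr (_ + _); apply: eq_bigr => j _; rewrite /c liftK.
apply: (sum_ge0_of_shifts _ _ (fun u : R[i] => cmodulus u = 1) _ c sh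
    (split_norm R p) 2 (2^-1 `^ (p / 2))).
- by rewrite /cmodulus ComplexField.Normc.normc1.
- by move=> u v u1 v1; rewrite normM u1 v1 mulr1.
- by move=> i; rewrite /sh; case: unlift.
- by move=> v; exact: split_norm_bounds.
- by rewrite powR_gt0// invr_gt0.
move=> u u1.
pose zu := \row_j (u * z ord0 j) : 'rV[R[i]]_d.
have zuE j : cmodulus (zu ord0 j) = cmodulus (z ord0 j) by rewrite mxE normM u1 mul1r.
have NE : \sum_(j < d) cmodulus (zu ord0 j) ^+ 2 = N.
  by apply: eq_bigr => j _; rewrite zuE.
have -> : \sum_(i < d.+1) c i * split_norm R p (u * sh i) =
  e * (\sum_(j < d) split_norm R p (zu ord0 j)
   - kappa * N `^ (p / 2) * split_norm R p (u * b)).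
  rewrite big_ord_recl {1}/c {1}/sh unlift_none mulrBr mulNr mulr_sumr addrC.
  congr (_ - _); last by rewrite !mulrA.
  apply: eq_bigr => j _; rewrite /c /sh liftK mxE -mulrA; congr (_ * _).
  rewrite [in RHS]za mulrCA /split_norm Re_realM Im_realM !normrM.
  by rewrite !powRM// ger0_norm ?cmodulus_ge0// mulrDr.
rewrite -NE; apply: (complexify_pointwise _ _ _ _ _ _ _ (cmodulus s)) => //.
- by under eq_bigr do rewrite mxE; rewrite -mulr_sumr z0 mulr0.
- by rewrite normM u1 b1 mulr1.
- by rewrite NE.
- under eq_bigr do rewrite mxE exprMn.
  by rewrite -mulr_sumr -/s [in LHS]sb exprMn mulrCA.
Qed.

(** * Existence of the real extremum *)

Local Open Scope classical_set_scope.

(** For [p <= 1] the function is not differentiable at the origin, where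
    continuity is checked by hand. *)
Lemma continuous_normr_powR (R : realType) (p : R) : 0 < p ->
  continuous (fun x : R => `|x| `^ p).
Proof.
move=> p0 x; have [->|x0] := eqVneq x 0.
  rewrite /continuous_at normr0 powR0 ?gt_eqF//.
  apply/cvgr0Pnorm_lt => eps e0.
  have e0' : 0 < eps `^ p^-1 by rewrite powR_gt0.
  have := @cvgr0_norm_lt _ _ _ _ (nbhs_filter (0 : R)) id cvg_id _ e0'.
  apply: filterS => y /= ye.
  rewrite ger0_norm ?powR_ge0//.
  have := gt0_ltr_powR p0 _ _ ye.
  rewrite -powRrM mulVf ?gt_eqF// powRr1 ?ltW//.
  by apply; rewrite nnegrE// ltW.
apply: (@continuous_comp _ _ _ (fun x : R => `|x|) (fun y : R => y `^ p)).
  exact: norm_continuous.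
apply/differentiable_continuous/derivable1_diffP.
by have [] := is_derive1_powR p (x := `|x|) (ltac:(by rewrite normr_gt0)).
Qed.

Lemma continuous_coord_sum (R : realType) (d : nat) (g : R -> R) :
  continuous g -> continuous (fun x : 'rV[R]_d => \sum_(j < d) g (x ord0 j)).
Proof.
move=> cg; apply: continuous_big => [|j _ x]; first exact: add_continuous.
apply: (@continuous_comp _ _ _ (fun x : 'rV[R]_d => x ord0 j) g).
  exact: coord_continuous.
exact: cg.
Qed.

Definition zero_sum_sphere (R : realType) (d : nat) : set 'rV[R]_d :=
  [set x | \sum_(j < d) x ord0 j ^+ 2 = 1 /\ \sum_(j < d) x ord0 j = 0].

(** A closed subset of the cube [[-1, 1]^d]. *)
Lemma compact_zero_sum_sphere (R : realType) (d : nat) :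
  compact (zero_sum_sphere R d).
Proof.
have -> : zero_sum_sphere R d =
    [set x : 'rV[R]_d | forall j, `[-1, 1]%classic (x ord0 j)] `&` zero_sum_sphere R d.
  apply/esym/setIidr => x [x1 _] j /=; rewrite in_itv/= -ler_norml.
  rewrite -(@ler_pXn2r _ 2)// ?nnegrE// expr1n real_normK ?num_real//.
  by rewrite -x1 (bigD1 j)//= lerDl sumr_ge0// => i _; exact: sqr_ge0.
apply: compact_closedI.
  by apply: (@rV_compact R d (fun=> `[-1, 1]%classic)) => _; exact: segment_compact.
apply: closedI.
  apply: (@preimage_closed _ _
    (fun x : 'rV[R]_d => \sum_(j < d) x ord0 j ^+ 2) [set t | t = 1]).
    move=> x _; apply: (@continuous_coord_sum R d (fun t => t ^+ 2)).
    exact: exprn_continuous.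
  exact: closed_eq.
apply: (@preimage_closed _ _
  (fun x : 'rV[R]_d => \sum_(j < d) x ord0 j) [set t | t = 0]).
  by move=> x _; apply: (@continuous_coord_sum R d id) => y; exact: cvg_id.
exact: closed_eq.
Qed.

Lemma zero_sum_sphere_normalize (R : realType) (d : nat) (x : 'rV[R]_d) :
  x != 0 -> \sum_(j < d) x ord0 j = 0 ->
  zero_sum_sphere R d ((Num.sqrt (\sum_(j < d) x ord0 j ^+ 2))^-1 *: x).
Proof.
move=> xn0 x0; set Q := \sum_(j < d) _.
have Q0 : 0 <= Q by apply: sumr_ge0 => j _; exact: sqr_ge0.
have Qn0 : Q != 0.
  apply: contra_neq xn0 => /eqP; rewrite psumr_eq0; last by move=> *; exact: sqr_ge0.
  move=> /allP Z; apply/rowP => j; rewrite mxE; apply/eqP.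
  by rewrite -sqrf_eq0; apply: Z; rewrite mem_index_enum.
split.
  under eq_bigr do rewrite mxE exprMn.
  by rewrite -mulr_sumr exprVn sqr_sqrtr// mulVf.
by under eq_bigr do rewrite mxE; rewrite -mulr_sumr x0 mulr0.
Qed.

Lemma zero_sum_sphere_nonempty (R : realType) (d : nat) : (1 < d)%N ->
  zero_sum_sphere R d !=set0.
Proof.
move=> d1.
pose i0 : 'I_d := Ordinal (ltnW d1); pose i1 : 'I_d := Ordinal d1.
pose x : 'rV[R]_d := delta_mx ord0 i0 - delta_mx ord0 i1.
exists ((Num.sqrt (\sum_(j < d) x ord0 j ^+ 2))^-1 *: x).
apply: zero_sum_sphere_normalize.
  apply/eqP => /rowP/(_ i0); rewrite !mxE !eqxx/= subr0.
  by move/eqP; rewrite oner_eq0.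
have D i : \sum_(j < d) ((ord0 == ord0 :> 'I_1) && (j == i))%:R = 1 :> R.
  rewrite (bigD1 i)//= !eqxx big1 ?addr0// => j ji.
  by rewrite (negbTE ji).
by under eq_bigr do rewrite !mxE; rewrite sumrB !D subrr.
Qed.

(** The extremal value on the compact sphere extends to all zero-sum vectors
    by homogeneity; the statement is free of quotients so that it also holds,
    and can be used, at [x = 0]. *)
Lemma signed_real_extremum (R : realType) (d : nat) (e p : R) :
  (1 < d)%N -> 0 < p ->
  exists2 x0 : 'rV[R]_d, zero_sum_sphere R d x0 &
    forall x : 'rV[R]_d, \sum_(j < d) x ord0 j = 0 ->
      0 <= e * (\sum_(j < d) `|x ord0 j| `^ p -
        (\sum_(j < d) `|x0 ord0 j| `^ p)
        * (\sum_(j < d) x ord0 j ^+ 2) `^ (p / 2)).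
Proof.
move=> d1 p0; pose f (x : 'rV[R]_d) := e * \sum_(j < d) `|x ord0 j| `^ p.
have cf : continuous f.
  move=> x; apply: (@continuous_comp _ _ _
    (fun x : 'rV[R]_d => \sum_(j < d) `|x ord0 j| `^ p) ( *%R e)).
    apply: (@continuous_coord_sum R d (fun t => `|t| `^ p)).
    exact: continuous_normr_powR.
  exact: mulrl_continuous.
have [] := compact_EVT_min (zero_sum_sphere_nonempty R d d1)
  (compact_zero_sum_sphere R d) (continuous_subspaceT cf).
move=> x0; rewrite inE => x0S Hmin; exists x0 => // x xs0.
have [->|xn0] := eqVneq x 0.
  rewrite [X in X - _]big1 => [|j _]; last by rewrite mxE normr0 powR0// gt_eqF.
  rewrite [X in X `^ (p / 2)]big1 => [|j _]; last by rewrite mxE expr0n.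
  by rewrite powR0 ?gt_eqF ?divr_gt0// mulr0 subr0 mulr0.
have := zero_sum_sphere_normalize R d x xn0 xs0.
set Q := \sum_(j < d) _ ^+ 2 => yS.
have Q0 : 0 <= Q by apply: sumr_ge0 => j _; exact: sqr_ge0.
have Qn0 : Q != 0.
  apply/eqP => Q0'; case: yS => /eqP; rewrite Q0' sqrtr0 invr0.
  rewrite scale0r big1 => [|j _]; first by rewrite eq_sym oner_eq0.
  by rewrite mxE expr0n.
have Qp0 : 0 < Q `^ (p / 2) by rewrite powR_gt0// lt_neqAle eq_sym Qn0.
have := Hmin _ (mem_set yS); rewrite /f.
have -> : \sum_(j < d) `|((Num.sqrt Q)^-1 *: x) ord0 j| `^ p =
    (Q `^ (p / 2))^-1 * \sum_(j < d) `|x ord0 j| `^ p.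
  rewrite mulr_sumr; apply: eq_bigr => j _.
  rewrite mxE normrM powRM// ger0_norm ?invr_ge0 ?sqrtr_ge0//; congr (_ * _).
  rewrite -powR12_sqrt// -[(Q `^ 2^-1)^-1]powRN -[(Q `^ (p / 2))^-1]powRN -powRrM.
  by rewrite mulNr mulrC.
move=> h.
(* Scaling back by the norm of x undoes the normalization. *)
suff : 0 <= Q `^ (p / 2) *
    (e * ((Q `^ (p / 2))^-1 * \sum_(j < d) `|x ord0 j| `^ p)
     - e * (\sum_(j < d) `|x0 ord0 j| `^ p)).
  by congr (0 <= _); field; rewrite gt_eqF.
by apply: mulr_ge0; [exact: ltW | rewrite subr_ge0].
Qed.

Local Close Scope classical_set_scope.

(** * Quotients of norms *)

(** Passage from the homogeneous inequality to the quotient of norms, by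
    monotonicity of the [p]-th root. *)
Lemma signed_ratio (R : realType) (e p P Q kappa : R) :
  e = 1 \/ e = - 1 -> 0 < p -> 0 <= P -> 0 < Q -> 0 <= kappa ->
  0 <= e * (P - kappa * Q `^ (p / 2)) ->
  0 <= e * (P `^ p^-1 / Q `^ 2^-1 - kappa `^ p^-1).
Proof.
move=> e1 p0 P0 Q0 k0.
have r0 : 0 <= p^-1 by rewrite invr_ge0 ltW.
have q0 : 0 < Q `^ 2^-1 by rewrite powR_gt0.
have E : (kappa * Q `^ (p / 2)) `^ p^-1 = kappa `^ p^-1 * Q `^ 2^-1.
  rewrite powRM ?powR_ge0// -powRrM; congr (_ * _ `^ _).
  by rewrite mulrAC mulfV ?mul1r// gt_eqF.
have mono x y : 0 <= x -> x <= y -> x `^ p^-1 <= y `^ p^-1.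
  by move=> x0 xy; apply: ge0_ler_powR; rewrite // nnegrE// (le_trans x0).
have kQ : 0 <= kappa * Q `^ (p / 2) by rewrite mulr_ge0 ?powR_ge0.
case: e1 => ->; rewrite ?mul1r ?mulN1r ?oppr_ge0 ?subr_ge0 ?subr_le0 => h.
- by rewrite ler_pdivlMr// -E mono.
- by rewrite ler_pdivrMr// -E mono.
Qed.

Lemma lpnorm2E (R : realType) (K : Type) (modulus : K -> R) (d : nat)
    (z : 'rV[K]_d) : (forall k, 0 <= modulus k) ->
  lpnorm modulus 2 z = (\sum_(j < d) modulus (z ord0 j) ^+ 2) `^ 2^-1.
Proof.
by move=> h; rewrite /lpnorm; under eq_bigr do rewrite powR_mulrn//.
Qed.

Lemma sum_sqr_modulus_gt0 (R : realType) (K : zmodType) (modulus : K -> R)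
    (d : nat) (z : 'rV[K]_d) :
  (forall k, modulus k = 0 -> k = 0) -> z != 0 ->
  0 < \sum_(j < d) modulus (z ord0 j) ^+ 2.
Proof.
move=> mod0 zn0; rewrite lt_neqAle eq_sym sumr_ge0 => [|j _]; last exact: sqr_ge0.
rewrite andbT; apply: contra_neq zn0 => /eqP.
rewrite psumr_eq0; last by move=> *; exact: sqr_ge0.
move=> /allP Z; apply/rowP => j; rewrite mxE; apply/mod0/eqP.
by rewrite -sqrf_eq0; apply: Z; rewrite mem_index_enum.
Qed.

Lemma cmodulus_real (R : realType) (x : R) : cmodulus x%:C%C = `|x|.
Proof. by rewrite /cmodulus/= expr0n addr0 sqrtr_sqr. Qed.

(** The common extremum is the [p]-th root of the extremal value [kappa] on the
    real sphere, attained over both fields at the same real vector. *)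
Lemma signed_common_extremum (R : realType) (d : nat) (e p : R) :
  (1 < d)%N -> 0 < p -> e = 1 \/ e = - 1 ->
  signed_concave R e (fun x => x `^ (p / 2)) ->
  exists m : R,
    (zero_sum_ratios (@cmodulus R) d p m /\
     forall y, zero_sum_ratios (@cmodulus R) d p y -> 0 <= e * (y - m)) /\
    (zero_sum_ratios (@rmodulus R) d p m /\
     forall y, zero_sum_ratios (@rmodulus R) d p y -> 0 <= e * (y - m)).
Proof.
move=> d1 p0 e1 conc.
have [x0 [x0S x0s] real] := signed_real_extremum R d e p d1 p0.
set kappa := \sum_(j < d) `|x0 ord0 j| `^ p in real.
have k0 : 0 <= kappa by apply: sumr_ge0 => j _; exact: powR_ge0.
have complex (z : 'rV[R[i]]_d) := complexify R d p e kappa z p0 k0 conc real.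
have rsqr (x : 'rV[R]_d) :
    \sum_(j < d) rmodulus (x ord0 j) ^+ 2 = \sum_(j < d) x ord0 j ^+ 2.
  by apply: eq_bigr => j _; rewrite real_normK ?num_real.
have x0n0 : x0 != 0.
  apply/eqP => x00; move/eqP: x0S; rewrite x00 big1 => [|j _]; first by rewrite eq_sym oner_eq0.
  by rewrite mxE expr0n.
exists (kappa `^ p^-1); split; split.
- exists (map_mx (real_complex R) x0); first split.
  + apply: contra_neq x0n0 => /rowP H; apply/rowP => j.
    by have := H j; rewrite !mxE => -[].
  + by under eq_bigr do rewrite mxE; rewrite -rmorph_sum/= x0s.
  rewrite lpnorm2E; last exact: cmodulus_ge0.
  under [X in _ / X `^ _]eq_bigr do rewrite mxE cmodulus_real.
  rewrite (rsqr x0) x0S powR1 divr1 /lpnorm.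
  by under eq_bigr do rewrite mxE cmodulus_real.
- move=> _ [z [zn0 zs] <-].
  rewrite lpnorm2E; last exact: cmodulus_ge0.
  apply: signed_ratio => //; last exact: complex.
    by apply: sumr_ge0 => j _; exact: powR_ge0.
  by apply: sum_sqr_modulus_gt0 => // k; exact: ComplexField.Normc.eq0_normc.
- exists x0 => //.
  rewrite lpnorm2E; last by move=> k; exact: normr_ge0.
  by rewrite rsqr x0S powR1 divr1.
- move=> _ [x [xn0 xs] <-].
  rewrite lpnorm2E; last by move=> k; exact: normr_ge0.
  apply: signed_ratio => //.
  + by apply: sumr_ge0 => j _; exact: powR_ge0.
  + by apply: sum_sqr_modulus_gt0 => // k; exact: normr0_eq0.
  + by rewrite rsqr; exact: real.
Qed.

Theorem mainTheorem3 (R : realType) (d : nat) (hd : (3 <= d)%N) :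
  (forall p : R, 0 < p -> p < 2 ->
     exists m : R,
       is_min (zero_sum_ratios (@cmodulus R) d p) m /\
       is_min (zero_sum_ratios (@rmodulus R) d p) m) /\
  (forall q : R, 2 < q ->
     exists m : R,
       is_max (zero_sum_ratios (@cmodulus R) d q) m /\
       is_max (zero_sum_ratios (@rmodulus R) d q) m).
Proof.
split=> [p p0 p2|q q2].
- have [|m [[cm cmin] [rm rmin]]] :=
    signed_common_extremum R d 1 p (ltnW hd) p0 (or_introl erefl).
    by apply: signed_concave_powR; lra.
  exists m; split; split=> // y.
    by move=> /cmin; rewrite mul1r subr_ge0.
  by move=> /rmin; rewrite mul1r subr_ge0.
- have q0 : 0 < q by apply: lt_trans q2.
  have [|m [[cm cmax] [rm rmax]]] :=
    signed_common_extremum R d (- 1) q (ltnW hd) q0 (or_intror erefl).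
    by apply: signed_concave_convex_powR; lra.
  exists m; split; split=> // y.
    by move=> /cmax; rewrite mulN1r oppr_ge0 subr_le0.
  by move=> /rmax; rewrite mulN1r oppr_ge0 subr_le0.
Qed.
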